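(* For all integers $k \geq 3$ and $r \geq 3$, $$ s_r(K_k) \leq 8 (k-1)^6 r^3 .$$
   Context: All graphs are finite and simple. For graphs $G,H$ and an integer $r\ge 1$, write $G \rightarrow (H)_r$ if every colouring of the edges of $G$ with $r$ colours contains a monochromatic copy of $H$. A graph $G$ is $r$-Ramsey-minimal for $H$ if $G \rightarrow (H)_r$ but no proper subgraph $G' \subsetneq G$ satisfies $G' \rightarrow (H)_r$. Define $s_r(H) := \min \delta(G)$, the minimum taken over all graphs $G$ that are $r$-Ramsey-minimal for $H$, where $\delta(G)$ is the minimum degree. $K_k$ denotes the complete graph on $k$ vertices. *)

(* Defs.v *)
From mathcomp Require Import all_boot.
Set Implicit Arguments. Unset Strict Implicit. Unset Printing Implicit Defensive.

Definition is_graph (T : finType) (V : {set T}) (E : rel T) : Prop :=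
  [/\ (forall x y, E x y = E y x),
      (forall x, ~~ E x x) &
      (forall x y, E x y -> (x \in V) && (y \in V))].

Definition is_subgraph (T : finType) (V' : {set T}) (E' : rel T)
    (V : {set T}) (E : rel T) : Prop :=
  [/\ is_graph V' E', V' \subset V & (forall x y, E' x y -> E x y)].

Definition proper_sub (T : finType) (V' : {set T}) (E' : rel T)
    (V : {set T}) (E : rel T) : Prop :=
  V' != V \/ exists x y, E x y && ~~ E' x y.

Definition contains_copy (T U : finType) (V : {set T}) (E : rel T)
    (H : rel U) : Prop :=
  exists f : U -> T, [/\ injective f, (forall u, f u \in V) &
                         (forall u v, H u v -> E (f u) (f v))].

(* G -> (H)_r : every r-colouring of the edges of G (a symmetric colour
   function on pairs; only its values on edges matter) has a monochromatic
   copy of H. *)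
Definition arrows (T U : finType) (V : {set T}) (E : rel T) (H : rel U)
    (r : nat) : Prop :=
  forall c : T -> T -> 'I_r, (forall x y, c x y = c y x) ->
    exists col : 'I_r,
      contains_copy V (fun x y => E x y && (c x y == col)) H.

Definition ramsey_minimal (T U : finType) (V : {set T}) (E : rel T)
    (H : rel U) (r : nat) : Prop :=
  [/\ is_graph V E, arrows V E H r &
      (forall (V' : {set T}) (E' : rel T), is_subgraph V' E' V E ->
          proper_sub V' E' V E -> ~ arrows V' E' H r)].

Definition deg (T : finType) (V : {set T}) (E : rel T) (v : T) : nat :=
  #|[set u in V | E v u]|.

Definition mindeg (T : finType) (V : {set T}) (E : rel T) : nat :=
  \big[minn/#|T|]_(v in V) deg V E v.

Definition complete (k : nat) : rel 'I_k := fun i j => i != j.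
Arguments complete k : clear implicits.

(* Main.v *)
Require Import Defs.
From mathcomp Require Import all_boot all_algebra all_field ring.
From Stdlib Require Import Classical_Prop.
Set Implicit Arguments. Unset Strict Implicit. Unset Printing Implicit Defensive.

(* Write m = k - 1 and let q be the power of 2 with m^2 r <= q < 2 m^2 r.
   On F_q^3 take r edge-disjoint K_k-free graphs: colour i lives on the lines of
   direction (1, l, l^2 + alpha_i), among which there are no triangles, and on
   each line it is a complete m-partite graph.  For a random choice of the
   partitions, every set of at least q^3 / r points contains a K_m of each
   colour, so every r-colouring of the q^3 <= 8 m^6 r^3 points has, for some i, a
   K_m of colour i whose vertices are all coloured i.

   The Nesetril-Rodl partite construction embeds this coloured graph into a graph
   H that has an r-colouring without monochromatic K_k, but such that every
   r-colouring of H without monochromatic K_k repeats the pattern, up to a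
   permutation of the colours, on some copy of it.  Attach to H one new vertex
   for each possible position of the copy, joined to its q^3 points: the result
   arrows K_k while H does not, so every minimal arrowing subgraph contains one of
   the new vertices, whose degree is at most q^3.  Since the copy may depend on
   the colouring, no signal senders are needed. *)

(** * Hales-Jewett and Ramsey *)

Section HalesJewett.
Variable A : finType.

Definition fill (a : A) (L : seq (option A)) : seq A := map (odflt a) L.

Lemma fill_cat a L L' : fill a (L ++ L') = fill a L ++ fill a L'.
Proof. exact: map_cat. Qed.

Lemma fill_Some a w : fill a (map Some w) = w.
Proof. by rewrite /fill -map_comp map_id_in. Qed.

(* Colour focusing, by induction on the letters on which the line is constant. *)
Lemma hales_jewett_seq (s : seq A) (C : finType) :
  exists N, forall c : seq A -> C, exists L,
    [/\ size L = N, None \in L &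
        {in s &, forall a b, c (fill a L) = c (fill b L)}].
Proof.
have trivial_line (t : seq A) (D : finType) : {in t &, forall a b, a = b} ->
    exists N, forall c : seq A -> D, exists L,
    [/\ size L = N, None \in L &
        {in t &, forall a b, c (fill a L) = c (fill b L)}].
  move=> ht; exists 1 => c; exists [:: None]; split=> // a b ha hb.
  by rewrite (ht a b).
elim: s C => [|a0 [|b s'] IH] C; [exact: trivial_line| |].
  by apply: trivial_line => a b /[!inE] /eqP -> /eqP ->.
set s := b :: s' in IH *; have sb : b \in s by rewrite mem_head.
(* Unless some line is monochromatic on all of [a0 :: s], there are [m] lines, each monochromatic on
   [s], with pairwise distinct colours and the same point [f] at the letter [a0]. *)
have focus m : exists N, forall c : seq A -> C,
    (exists L, [/\ size L = N, None \in L &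
       {in a0 :: s &, forall a a', c (fill a L) = c (fill a' L)}]) \/
    (exists Ls f, [/\ size Ls = m, size f = N,
       uniq [seq c (fill b L) | L <- Ls] &
       forall L, L \in Ls -> [/\ size L = N, None \in L, fill a0 L = f &
          {in s, forall a, c (fill a L) = c (fill b L)}]]).
  elim: m => [|m [N IHm]].
    by exists 0 => c; right; exists [::], [::]; split.
  (* A prefix of length [M] is coloured by the whole colouring that it induces on suffixes of length
     [N]. *)
  have [M hM] := IH {ffun N.-tuple A -> C}.
  exists (M + N) => c.
  have [L0 [sz0 none0 cst0]] := hM (fun u => [ffun w : N.-tuple A => c (u ++ w)]).
  pose c2 w := c (fill b L0 ++ w).
  have c2E a w : a \in s -> size w = N -> c (fill a L0 ++ w) = c2 w.
    move=> sa /eqP szw; have := cst0 _ _ sa sb.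
    by move/ffunP/(_ (Tuple szw)); rewrite !ffunE.
  have lift_line L : size L = N -> None \in L ->
      (forall a, a \in s -> c2 (fill a L) = c2 (fill b L)) ->
      c2 (fill a0 L) = c2 (fill b L) ->
      exists L, [/\ size L = M + N, None \in L &
       {in a0 :: s &, forall a a', c (fill a L) = c (fill a' L)}].
    move=> sz none cs ca0; exists (map Some (fill b L0) ++ L).
    have cst a : a \in a0 :: s -> c2 (fill a L) = c2 (fill b L).
      by rewrite in_cons => /predU1P [-> //|]; apply: cs.
    split; first by rewrite size_cat !size_map sz0 sz.
      by rewrite mem_cat none orbT.
    by move=> a a' sa sa'; rewrite !fill_cat !fill_Some -!/(c2 _) !cst.
  case: (IHm c2) => [[L [sz none cst]]|[Ls [f [szLs szf uLs hLs]]]].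
    left; apply: (lift_line L) => // [a sa|]; apply: cst;
      by rewrite in_cons ?sa ?sb ?eqxx ?orbT.
  (* If the colour of the focus [f] is already used, the line of that colour extends to [a0];
     otherwise the line that moves only in the prefix adds a new colour. *)
  have [/mapP [L LLs fE]|fNLs] := boolP (c2 f \in [seq c2 (fill b L) | L <- Ls]).
    have [sz none ff cst] := hLs L LLs.
    by left; apply: (lift_line L); rewrite ?ff.
  right; exists ((L0 ++ map Some f) :: map (cat L0) Ls), (fill a0 L0 ++ f).
  split; first by rewrite /= size_map szLs.
  - by rewrite size_cat size_map sz0 szf.
  - rewrite /= fill_cat fill_Some -map_comp.
    rewrite (eq_map (g := fun L => c2 (fill b L))) ?fNLs //.
    by move=> L /=; rewrite fill_cat.
  move=> L; rewrite in_cons => /predU1P [->|/mapP [L1 /hLs [sz none ff cst] ->]].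
    split; first by rewrite size_cat size_map sz0 szf.
    + by rewrite mem_cat none0.
    + by rewrite fill_cat fill_Some.
    + by move=> a sa; rewrite !fill_cat !fill_Some !c2E.
  split; first by rewrite size_cat sz0 sz.
  + by rewrite mem_cat none0.
  + by rewrite fill_cat ff.
  by move=> a sa; rewrite !fill_cat !c2E ?size_map // cst.
have [N hN] := focus #|C|.+1; exists N => c.
case: (hN c) => // [[Ls [f [szLs _ uLs _]]]].
have := max_card (mem [seq c (fill b L) | L <- Ls]).
by rewrite (card_uniqP uLs) size_map szLs ltnn.
Qed.

Lemma hales_jewett (C : finType) :
  exists N, forall c : N.-tuple A -> C, exists L : N.-tuple (option A),
    None \in L /\ forall a b,
      c [tuple of map (odflt a) L] = c [tuple of map (odflt b) L].
Proof.
have [N hN] := hales_jewett_seq (enum A) (option C).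
exists N => c.
have [L [szL none cst]] := hN (fun w => omap c (insub w)).
have szL' : size L == N by rewrite szL.
exists (Tuple szL'); split=> // a b.
have := cst a b; rewrite !mem_enum => /(_ isT isT).
have insL d : insub (fill d L) = Some [tuple of map (odflt d) (Tuple szL')].
  by rewrite -(valK [tuple of map (odflt d) (Tuple szL')]).
by rewrite !insL => -[].
Qed.

End HalesJewett.

Lemma pigeonhole (T C : finType) (c0 : C) (S : {set T}) (f : T -> C) :
  exists c, #|S| <= #|C| * #|[set x in S | f x == c]|.
Proof.
pose F c := #|[set x in S | f x == c]|.
exists [arg max_(c > c0) F c]; case: arg_maxnP => // c _ hc.
have -> : #|S| = \sum_d F d.
  rewrite -sum1_card (partition_big f predT) //=; apply: eq_bigr => d _.
  by rewrite /F -sum1_card; apply: eq_bigl => x; rewrite inE.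
by rewrite -sum_nat_const; apply: leq_sum => d _; apply: hc.
Qed.

(** Greedy choice: take a vertex, keep its largest colour class among the remaining ones, and
    repeat. The colour of a pair then depends only on its earlier vertex, and [s] stores it
    there. *)
Lemma end_homogeneous (C : finType) (c0 : C) (m : nat) :
  exists N, forall (A : finType) (t : A -> A -> C) (S : {set A}), N <= #|S| ->
    exists s : seq (A * C),
      [/\ size s = m, uniq (map fst s), {subset map fst s <= S} &
          pairwise (fun u v => t u.1 v.1 == u.2) s].
Proof.
elim: m => [|m [N IH]]; first by exists 0 => A t S _; exists [::].
exists (#|C| * N).+1 => A t S hS.
have /card_gt0P [x xS] : 0 < #|S| by apply: leq_trans hS.
have [c hc] := pigeonhole c0 (S :\ x) (t x).
have : #|C| * N <= #|S :\ x| by move: hS; rewrite (cardsD1 x S) xS.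
move/leq_trans/(_ hc); rewrite leq_pmul2l; last by apply/card_gt0P; exists c0.
move=> /(IH A t) [s [sz us sS ps]]; exists ((x, c) :: s).
have sx y : y \in map fst s -> [/\ y != x, y \in S & t x y == c].
  by move=> /sS; rewrite !inE -andbA => /and3P [].
split=> /=; rewrite ?sz ?us ?ps ?andbT //.
- by apply/negP => /sx []; rewrite eqxx.
- by move=> y; rewrite in_cons => /predU1P [-> //|/sx []].
by apply/allP => u us'; have [] := sx u.1 (map_f _ us').
Qed.

Lemma ramsey (C : finType) (c0 : C) (n : nat) :
  exists N, forall t : 'I_N -> 'I_N -> C, exists (s : n.-tuple 'I_N) (c : C),
    uniq s /\ pairwise (fun x y => t x y == c) s.
Proof.
have [N hN] := end_homogeneous c0 (#|C| * n).
exists N => t; have [|s [sz us _ ps]] := hN _ t setT; first by rewrite cardsT card_ord.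
have [c hc] := pigeonhole c0 [set u in s] snd.
have uns : uniq s := map_uniq us.
have : n <= size [seq u <- s | u.2 == c].
  have cC : 0 < #|C| by apply/card_gt0P; exists c0.
  rewrite -(leq_pmul2l cC) -sz.
  have -> : size s = #|[set u in s]|.
    by rewrite -(card_uniqP uns); apply: eq_card => u; rewrite inE.
  apply: leq_trans hc _; rewrite leq_pmul2l //.
  rewrite -(card_uniqP (filter_uniq _ uns)) subset_leq_card //.
  by apply/subsetP => u; rewrite !inE mem_filter andbC.
set s1 := filter _ s => szs1.
have szs2 : size (take n (map fst s1)) == n by rewrite size_takel // size_map.
have sub : subseq (take n (map fst s1)) (map fst s1) by apply: take_subseq.
exists (Tuple szs2), c; split.
  apply: subseq_uniq sub _; apply: subseq_uniq us.
  by apply: map_subseq; apply: filter_subseq.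
apply: subseq_pairwise sub _; rewrite pairwise_map.
have : pairwise (fun u v => t u.1 v.1 == u.2) s1.
  by apply: subseq_pairwise ps; apply: filter_subseq.
apply: (sub_in_pairwise (P := fun u => u.2 == c)); last exact: filter_all.
by move=> u v /eqP <-.
Qed.

(** * The partite construction *)

Definition clique (k : nat) (T : finType) (R : rel T) (f : 'I_k -> T) : Prop :=
  forall u v, u != v -> R (f u) (f v).

(** An edge-coloured graph without monochromatic K_k is encoded by its colour classes, as disjoint
    relations. *)
Definition clique_free_coloring (k : nat) (I T : finType) (R : I -> rel T) :=
  [/\ forall i, symmetric (R i), forall i, irreflexive (R i),
      forall i j x y, R i x y -> R j x y -> i = j &
      forall i (f : 'I_k -> T), ~ clique (R i) f].

Definition partite (A I T : finType) (p : T -> A) (R : I -> rel T) :=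
  forall i x y, R i x y -> p x != p y.

Section PartiteAmalgamation.
Variables (k : nat) (A I C X : finType) (p : X -> A) (R : I -> rel X).
Variables (a b : A) (kap : I).
Hypotheses (k_gt2 : 2 < k) (Rk : clique_free_coloring k R) (Rp : partite p R).

(** The alphabet for Hales-Jewett; in a [line], [None] marks an active coordinate. *)
Let E := {e : X * X | [&& p e.1 == a, p e.2 == b & R kap e.1 e.2]}.
Let ab := [:: a; b].

Variable N : nat.
Let line := N.-tuple (option E).
(** The copies share the tuples, which replace the parts [a] and [b]; every other vertex gets one
    copy per line. *)
Let X' : finType := (N.-tuple X + line * X)%type.

Let pick_end (x : X) (e : E) : X := if p x == a then (val e).1 else (val e).2.

(** The copy along [L]: in the parts [a] and [b], active coordinates hold [x] itself, and fixed ones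
    hold the end, in the part of [x], of the edge that [L] prescribes. *)
Let phi (L : line) (x : X) : X' :=
  if p x \in ab then inl [tuple of map (oapp (pick_end x) x) L] else inr (L, x).

Let p' (u : X') : A :=
  match u with inl w => oapp p a (ohead w) | inr Lx => p Lx.2 end.

Let R' (i : I) (u v : X') : bool :=
  [exists L : line, exists x, exists y,
    [&& None \in L, u == phi L x, v == phi L y & R i x y]].

Let R'P i u v : reflect (exists L : line, exists x, exists y,
  [/\ None \in L, u = phi L x, v = phi L y & R i x y]) (R' i u v).
Proof.
apply: (iffP existsP) => -[L].
  move=> /existsP [x /existsP [y /and4P [hL /eqP hu /eqP hv hR]]].
  by exists L, x, y.
move=> [x [y [hL -> -> hR]]]; exists L; apply/existsP; exists x.
by apply/existsP; exists y; rewrite hL !eqxx hR.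
Qed.

Let p_pick x (e : E) : p x \in ab -> p (pick_end x e) = p x.
Proof.
have /and3P [/eqP pa /eqP pb _] := valP e.
by rewrite !inE /pick_end; case: eqP => [->|_ /eqP ->].
Qed.

Let p_phi (L : line) x : None \in L -> p' (phi L x) = p x.
Proof.
rewrite /phi; case: ifP => //= xab.
case: L => -[|[e|] L] //= _ _; exact: p_pick.
Qed.

Let R_pick x y (e : E) : p x \in ab -> p y \in ab -> p x != p y ->
  R kap (pick_end x e) (pick_end y e).
Proof.
have [sR _ _ _] := Rk.
have /and3P [/eqP pa /eqP pb Re] := valP e.
rewrite !inE /pick_end; case: (val e) Re => e1 e2 /= Re.
case: (p x =P a) => [-> _|_ /eqP ->]; case: (p y =P a) => [->|_ /eqP ->];
  by rewrite ?eqxx // sR.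
Qed.

Let phi_inj_out (L L' : line) x x' :
  None \in L -> None \in L' -> p x \notin ab -> phi L x = phi L' x' ->
  L = L' /\ x = x'.
Proof.
move=> hL hL' xab e.
have px : p x = p x' by rewrite -(p_phi x hL) e p_phi.
by move: e; rewrite /phi -px (negPf xab) => -[].
Qed.

Let phi_coord (L L' : line) x x' t :
  None \in L -> None \in L' -> p x \in ab -> phi L x = phi L' x' ->
  oapp (pick_end x) x (tnth L t) = oapp (pick_end x') x' (tnth L' t).
Proof.
move=> hL hL' xab e.
have px : p x = p x' by rewrite -(p_phi x hL) e p_phi.
move: e; rewrite /phi -px xab => -[e].
have /(congr1 (fun w => tnth w t)) : [tuple of map (oapp (pick_end x) x) L]
  = [tuple of map (oapp (pick_end x') x') L'] by apply: val_inj.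
by rewrite !tnth_map.
Qed.

Let phi_inj (L : line) : None \in L -> injective (phi L).
Proof.
move=> hL x x' e; have [xab|xab] := boolP (p x \in ab); last first.
  by have [] := phi_inj_out hL hL xab e.
have /tnthP [t Lt] := hL.
by have := phi_coord t hL hL xab e; rewrite -Lt.
Qed.

(* [phi L] is an induced embedding: on the two amalgamated parts, compare an
   active coordinate of each of the two lines. *)
Let phi_induced (L : line) j x y :
  None \in L -> R' j (phi L x) (phi L y) -> R j x y.
Proof.
have [sR _ dR _] := Rk.
move=> hL /R'P [L' [x' [y' [hL' ex ey Rxy']]]].
have [xab|xab] := boolP (p x \in ab); last first.
  have [eL ->] := phi_inj_out hL hL' xab ex.
  by move: ey; rewrite -eL => /(phi_inj hL) ->.
have [yab|yab] := boolP (p y \in ab); last first.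
  have [eL ->] := phi_inj_out hL hL' yab ey.
  by move: ex; rewrite -eL => /(phi_inj hL) ->.
have px : p x = p x' by rewrite -(p_phi x hL) ex p_phi.
have py : p y = p y' by rewrite -(p_phi y hL) ey p_phi.
have xab' : p x' \in ab by rewrite -px.
have yab' : p y' \in ab by rewrite -py.
have pxy' := Rp Rxy'.
have /tnthP [t Lt] := hL; have /tnthP [t' Lt'] := hL'.
have := phi_coord t hL hL' xab ex; have := phi_coord t hL hL' yab ey.
(* If [L'] is active at [t], both edges coincide. Otherwise [x] and [y] are the ends of [e], so
   [kap] joins them; coordinate [t'] then gives either [j = kap] or again the same edge. *)
rewrite -Lt /=; case: (tnth L' t) => [e|] /= ey1 ex1; last by rewrite ex1 ey1.
have := phi_coord t' hL hL' xab ex; have := phi_coord t' hL hL' yab ey.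
rewrite -Lt' /=; case: (tnth L t') => [e'|] /= ey' ex'.
  have -> : j = kap.
    by apply: dR Rxy' _; rewrite -ex' -ey'; apply: R_pick; rewrite ?px ?py.
  by rewrite ex1 ey1; apply: R_pick.
by rewrite ex' ey'.
Qed.

Let R'_sym i : symmetric (R' i).
Proof.
have [sR _ _ _] := Rk.
suff h u v : R' i u v -> R' i v u by move=> u v; apply/idP/idP; apply: h.
move=> /R'P [L [x [y [hL -> -> hR]]]]; apply/R'P.
by exists L, y, x; split=> //; rewrite sR.
Qed.

Let R'_partite : partite p' R'.
Proof.
by move=> i u v /R'P [L [x [y [hL -> -> /Rp hR]]]]; rewrite !p_phi.
Qed.

Let R'_coloring : clique_free_coloring k R'.
Proof.
have [sR _ dR cR] := Rk.
split=> //.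
- move=> i u; case Ruu: (R' i u u) => //.
  by have := R'_partite Ruu; rewrite eqxx.
- move=> i j u v /R'P [L [x [y [hL -> -> Rx]]]] /(phi_induced hL).
  exact: dR.
move=> i f cf.
have p'f_inj : injective (p' \o f).
  move=> u v /= e; apply: contraTeq isT => /cf Ruv.
  by have := R'_partite Ruv; rewrite e eqxx.
(* As k > 2, some vertex of a clique lies outside the two parts, hence in a
   single copy of the old picture, which then contains the whole clique. *)
have [u0 u0ab] : exists u, p' (f u) \notin ab.
  apply/existsP; apply: contraLR k_gt2 => /existsPn h.
  suff : size (map (p' \o f) (enum 'I_k)) <= size ab.
    by rewrite size_map size_enum_ord -leqNgt.
  apply: uniq_leq_size; first by rewrite map_inj_uniq ?enum_uniq.
  by move=> z /mapP [u _ ->]; have := h u; rewrite negbK.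
have [u1 u01] : exists u, u0 != u.
  have /card_gt1P [u [v [_ _ uv]]] : 1 < #|'I_k|.
    by rewrite card_ord; apply: leq_trans k_gt2.
  by have [->|] := eqVneq u0 u; [exists v | exists u].
have [L [x0 [_ [hL f0 _ _]]]] := R'P _ _ _ (cf _ _ u01).
have x0ab : p x0 \notin ab by rewrite -(p_phi x0 hL) -f0.
have im u : exists x, f u = phi L x.
  have [<-|] := eqVneq u0 u; first by exists x0.
  move=> /cf /R'P [L' [x [y [hL' e -> _]]]].
  by move: e; rewrite f0 => /(phi_inj_out hL hL' x0ab) [<- _]; exists y.
have [g fg] : exists g : 'I_k -> X, forall u, f u = phi L (g u).
  exact: fin_all_exists im.
by apply: (cR i g) => u v /cf; rewrite !fg; apply: phi_induced.
Qed.

(** A word of [kap]-edges is a pair of tuples, its first and its second ends, so [c] colours words.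
    For a monochromatic line [L], [phi L] sends each [kap]-edge between [a] and [b] to [L] filled
    with that edge. *)
Lemma partite_amalgam_of_line :
  (forall c : N.-tuple E -> C, exists L : line, None \in L /\ forall e e',
      c [tuple of map (odflt e) L] = c [tuple of map (odflt e') L]) ->
  exists (Y : finType) (q : Y -> A) (S : I -> rel Y),
    [/\ clique_free_coloring k S, partite q S &
     forall c : Y -> Y -> C, exists g : X -> Y,
      [/\ forall x, q (g x) = p x,
          forall i x y, R i x y -> S i (g x) (g y) &
          forall x y x1 y1, p x = a -> p y = b -> R kap x y ->
            p x1 = a -> p y1 = b -> R kap x1 y1 ->
            c (g x) (g y) = c (g x1) (g y1)]].
Proof.
move=> hj; exists X', p', R'; split=> // c.
have [L [hL cst]] := hj (fun w =>
   c (inl [tuple of map (fun e => (val e).1) w])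
     (inl [tuple of map (fun e => (val e).2) w])).
exists (phi L); split.
- by move=> x; apply: p_phi.
- by move=> i x y Rxy; apply/R'P; exists L, x, y.
have edge x y (xa : p x = a) (yb : p y = b) (Rxy : R kap x y) :
    exists e : E, phi L x =
        inl [tuple of map (fun e => (val e).1) [tuple of map (odflt e) L]] /\
      phi L y =
        inl [tuple of map (fun e => (val e).2) [tuple of map (odflt e) L]].
  have he : [&& p (x, y).1 == a, p (x, y).2 == b & R kap (x, y).1 (x, y).2].
    by rewrite /= xa yb !eqxx.
  have ba : (b == a) = false.
    by rewrite -xa -yb eq_sym; apply: negPf (Rp Rxy).
  exists (Sub (x, y) he); rewrite /phi xa yb !inE !eqxx orbT /=.
  split; congr inl; apply: val_inj; rewrite /= -map_comp; apply: eq_map;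
    by case=> [e|] //=; rewrite /pick_end ?xa ?yb ?ba ?eqxx.
move=> x y x1 y1 xa yb Rxy xa1 yb1 Rxy1.
have [e [-> ->]] := edge x y xa yb Rxy.
have [e1 [-> ->]] := edge x1 y1 xa1 yb1 Rxy1.
exact: cst.
Qed.

End PartiteAmalgamation.

(** * Iterated amalgamation and the edge-Ramsey property *)

Section EdgeRamsey.
Variables (k : nat) (I C : finType).
Hypothesis k_gt2 : 2 < k.

(** One amalgamation per triple: the uniformity for [l] is found inside a copy on which the head
    triple is already uniform. *)
Lemma partite_ramsey (A X : finType) (p : X -> A) (R : I -> rel X)
    (l : seq (A * A * I)) :
  clique_free_coloring k R -> partite p R ->
  exists (Y : finType) (q : Y -> A) (S : I -> rel Y),
    [/\ clique_free_coloring k S, partite q S &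
     forall c : Y -> Y -> C, exists g : X -> Y,
      [/\ forall x, q (g x) = p x,
          forall i x y, R i x y -> S i (g x) (g y) &
          forall a b i x y x1 y1, (a, b, i) \in l ->
            p x = a -> p y = b -> R i x y ->
            p x1 = a -> p y1 = b -> R i x1 y1 ->
            c (g x) (g y) = c (g x1) (g y1)]].
Proof.
move=> Rk Rp; elim: l => [|[[a b] i] l [Y [q [S [Sk Sp IH]]]]].
  by exists X, p, R; split=> // c; exists id; split.
have [N hN] := hales_jewett
  {e : Y * Y | [&& q e.1 == a, q e.2 == b & S i e.1 e.2]} C.
have [Z [r [T [Tk Tp hZ]]]] := partite_amalgam_of_line k_gt2 Sk Sp hN.
exists Z, r, T; split=> // c.
have [g [qg Sg cg]] := hZ c.
have [h [qh Rh ch]] := IH (fun x y => c (g x) (g y)).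
exists (g \o h); split.
- by move=> x /=; rewrite qg qh.
- by move=> j x y /Rh /Sg.
move=> a' b' j x y x1 y1; rewrite in_cons => /predU1P [[-> -> ->]|hl].
  by move=> xa yb Rxy xa1 yb1 Rxy1; apply: cg; rewrite ?qh //; apply: Rh.
exact: ch.
Qed.

(* The Nesetril-Rodl partite construction. *)
Lemma clique_free_edge_ramsey (T : finType) (R : I -> rel T) :
  clique_free_coloring k R ->
  exists (Y : finType) (S : I -> rel Y), clique_free_coloring k S /\
    forall c : Y -> Y -> C, (forall x y, c x y = c y x) ->
    exists g : T -> Y,
      [/\ injective g, forall i x y, R i x y -> S i (g x) (g y) &
          forall i x y x1 y1, R i x y -> R i x1 y1 ->
            c (g x) (g y) = c (g x1) (g y1)].
Proof.
move=> [sR iR dR cR].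
(* Ramsey is applied to pairs of parts: the type of a pair records, for each [i], the colour of the
   [i]-edges between the two parts, or [None] if there are none. *)
have [N hN] := ramsey ([ffun=> None] : {ffun I -> option C}) #|T|.
(* Disjoint copies of the graph, one for each injective placement of [T] into the [N] parts; other
   placements carry no edges. *)
pose X : finType := ({ffun T -> 'I_N} * T)%type.
pose p (x : X) : 'I_N := x.1 x.2.
pose R0 i (x y : X) := [&& x.1 == y.1, injectiveb x.1 & R i x.2 y.2].
have R0p : partite p R0.
  move=> i [h x] [h' y] /and3P [/= /eqP <- /injectiveP hi Rxy].
  by apply: contraTneq Rxy => /hi /= ->; rewrite iR.
have R0k : clique_free_coloring k R0.
  split.
  - move=> i [h x] [h' y]; rewrite /R0 /= eq_sym sR.
    by case: eqP => // ->.
  - by move=> i [h x]; rewrite /R0 /= iR !andbF.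
  - by move=> i j x y /and3P [_ _ +] /and3P [_ _]; apply: dR.
  by move=> i f cf; apply: (cR i (snd \o f)) => u v /cf /and3P [].
have [Y [q [S [Sk Sp hY]]]] := partite_ramsey (enum {: 'I_N * 'I_N * I}) R0k R0p.
exists Y, S; split=> // c c_sym.
have [g [qg Rg cg]] := hY c.
have {}cg a b i x y x1 y1 : p x = a -> p y = b -> R0 i x y ->
    p x1 = a -> p y1 = b -> R0 i x1 y1 -> c (g x) (g y) = c (g x1) (g y1).
  by apply: cg; rewrite mem_enum.
pose t (a b : 'I_N) := [ffun i => omap (fun e => c (g e.1) (g e.2))
  [pick e : X * X | [&& p e.1 == a, p e.2 == b & R0 i e.1 e.2]]].
have [s [d [us ps]]] := hN t.
(* The copy placed in order on the homogeneous parts [s]; there the colour of an edge depends only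
   on [i]. *)
pose h := [ffun x : T => tnth s (enum_rank x)].
have h_inj : injective h.
  by move=> x y; rewrite !ffunE => /(tuple_uniqP _ us) /enum_rank_inj.
have R0h i x y : R i x y -> R0 i (h, x) (h, y).
  by move=> Rxy; rewrite /R0 /= eqxx Rxy andbT; apply/injectiveP.
exists (fun x => g (h, x)); split.
- move=> x y /(congr1 q); rewrite !qg; exact: h_inj.
- by move=> i x y /R0h /Rg.
have color_lt i x y : R i x y -> enum_rank x < enum_rank y ->
    Some (c (g (h, x)) (g (h, y))) = d i.
  move=> Rxy xy.
  have /(pairwiseP (h x)) := ps => /(_ (enum_rank x) (enum_rank y)).
  rewrite !inE !size_tuple !ltn_ord => /(_ isT isT xy).
  rewrite -!tnth_nth => /eqP <-; rewrite ffunE.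
  case: pickP => [[e1 e2] /= /and3P [/eqP p1 /eqP p2 Re]|].
    congr Some; apply: (cg (h x) (h y) i) => //; first exact: R0h.
    + by rewrite p1 ffunE.
    + by rewrite p2 ffunE.
  by move=> /(_ ((h, x), (h, y))); rewrite /= /p /= !ffunE !eqxx R0h.
have color i x y : R i x y -> Some (c (g (h, x)) (g (h, y))) = d i.
  move=> Rxy; case: (ltngtP (enum_rank x) (enum_rank y)) => [|lt|/val_inj].
  - exact: color_lt.
  - by rewrite c_sym; apply: color_lt; rewrite // sR.
  by move=> /enum_rank_inj xy; move: Rxy; rewrite xy iR.
by move=> i x y x1 y1 /color + /color e1; rewrite -e1 => -[].
Qed.

End EdgeRamsey.

(** * Minimal subgraphs and gadgets *)

(** Passing to a proper arrowing subgraph loses a vertex or an edge, so the descent stops. *)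
Lemma minimal_subgraph (T U : finType) (V : {set T}) (E : rel T) (H : rel U) r :
  is_graph V E -> arrows V E H r ->
  exists (V' : {set T}) (E' : rel T),
    is_subgraph V' E' V E /\ ramsey_minimal V' E' H r.
Proof.
pose edges (E : rel T) := [set xy : T * T | E xy.1 xy.2].
have [n] := ubnP (#|V| + #|edges E|).
elim: n V E => // n IH V E; rewrite ltnS => szE gVE arr.
case: (classic (exists (V' : {set T}) (E' : rel T),
  [/\ is_subgraph V' E' V E, Defs.proper_sub V' E' V E & arrows V' E' H r])).
  move=> [V' [E' [[g' sV sE] prop arr']]].
  have sE' : edges E' \subset edges E.
    by apply/subsetP => -[x y]; rewrite !inE; apply: sE.
  have lt : #|V'| + #|edges E'| < #|V| + #|edges E|.
    case: prop => [neqV|[x [y /andP [Exy nExy]]]].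
      rewrite -addSn; apply: leq_add; last exact: subset_leq_card.
      by apply: proper_card; rewrite properEneq neqV.
    rewrite -addnS; apply: leq_add; first exact: subset_leq_card.
    by apply: proper_card; apply/properP; split=> //; exists (x, y); rewrite !inE.
  have [V2 [E2 [[g2 sV2 sE2] min2]]] := IH V' E' (leq_trans lt szE) g' arr'.
  exists V2, E2; split=> //; split=> //; first exact: subset_trans sV2 sV.
  by move=> x y /sE2 /sE.
move=> nex; exists V, E; split; first by split.
by split=> // V' E' sub prop arr'; apply: nex; exists V', E'.
Qed.

Lemma geq_bigminn (T : finType) (F : T -> nat) (P : pred T) n v :
  P v -> \big[minn/n]_(u | P u) F u <= F v.
Proof.
move=> Pv; have : v \in index_enum T by rewrite mem_index_enum.
elim: (index_enum T) => // u l IH; rewrite in_cons big_cons.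
case/predU1P => [<-|/IH le_v]; first by rewrite Pv geq_minl.
by case: ifP => // _; apply: leq_trans (geq_minr _ _) le_v.
Qed.

(** By the colouring [c], no arrowing subgraph avoids [B]; a minimal one thus has a vertex in [B],
    of degree at most [D]. *)
Lemma low_degree_minimal (k r D : nat) (T : finType) (E : rel T) (B : {set T}) :
  symmetric E -> irreflexive E -> arrows setT E (complete k) r ->
  (exists c : T -> T -> 'I_r, (forall x y, c x y = c y x) /\
     forall i, ~ contains_copy (~: B) (fun x y => E x y && (c x y == i))
                   (complete k)) ->
  (forall v, v \in B -> #|[set u | E v u]| <= D) ->
  exists (n : nat) (V : {set 'I_n}) (F : rel 'I_n),
    ramsey_minimal V F (complete k) r /\ mindeg V F <= D.
Proof.
move=> sE iE arr [c [c_sym noc]] degB.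
pose F0 (i j : 'I_#|T|) := E (enum_val i) (enum_val j).
have gF0 : is_graph setT F0.
  split; first by move=> i j; apply: sE.
    by move=> i; rewrite /F0 iE.
  by move=> i j; rewrite !inE.
have arrF0 : arrows setT F0 (complete k) r.
  move=> d d_sym.
  have [|i [f [fi _ fE]]] := arr (fun x y => d (enum_rank x) (enum_rank y)).
    by move=> x y; apply: d_sym.
  exists i, (enum_rank \o f); split=> //.
    by move=> u v /enum_rank_inj /fi.
  by move=> u v /fE; rewrite /F0 /= !enum_rankK.
have [V [F [[gF _ sF] minF]]] := minimal_subgraph gF0 arrF0.
exists #|T|, V, F; split=> //.
have [v vV vB] : exists2 v, v \in V & enum_val v \in B.
  case: (boolP [exists v in V, enum_val v \in B]) => [/exists_inP //|].
  rewrite negb_exists_in => /forall_inP VB; exfalso.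
  have [_ arrF _] := minF.
  have [|i [f [fi fV fF]]] := arrF (fun x y => c (enum_val x) (enum_val y)).
    by move=> x y; apply: c_sym.
  apply: (noc i); exists (enum_val \o f); split.
  - by move=> u v /= /enum_val_inj /fi.
  - by move=> u; rewrite inE; apply: VB.
  by move=> u v /fF /andP [/sF Fuv cuv]; apply/andP.
apply: leq_trans (geq_bigminn _ _ vV) _.
apply: leq_trans _ (degB _ vB).
rewrite /deg -(card_imset _ enum_val_inj); apply: subset_leq_card.
by apply/subsetP => _ /imsetP [u + ->]; rewrite !inE => /andP [_ /sF].
Qed.

(** * Disjoint unions and gadgets that separate colours *)

Section Gadgets.
Variable k : nat.
Hypothesis k_gt2 : 2 < k.

Lemma clique_free_sum (I S T : finType) (R : I -> rel S) (Q : I -> rel T) :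
  clique_free_coloring k R -> clique_free_coloring k Q ->
  clique_free_coloring k (fun i (x y : S + T) =>
    match x, y with
    | inl x, inl y => R i x y
    | inr x, inr y => Q i x y
    | _, _ => false
    end).
Proof.
move=> [sR iR dR cR] [sQ iQ dQ cQ].
have k_gt0 : 0 < k by apply: leq_trans k_gt2.
pose u0 := Ordinal k_gt0; split.
- by move=> i [x|x] [y|y] //; [apply: sR | apply: sQ].
- by move=> i [x|x]; [apply: iR | apply: iQ].
- by move=> i j [x|x] [y|y] //; [apply: dR | apply: dQ].
move=> i f cf; case f0 : (f u0) => [x0|x0].
  have [g fg] : exists g, forall u, f u = inl (g u).
    apply: (@fin_all_exists _ _ (fun u x => f u = inl x)) => u.
    have [<-|/cf] := eqVneq u0 u; first by exists x0.
    by rewrite f0; case: (f u) => // x _; exists x.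
  by apply: (cR i g) => u v /cf; rewrite !fg.
have [g fg] : exists g, forall u, f u = inr (g u).
  apply: (@fin_all_exists _ _ (fun u x => f u = inr x)) => u.
  have [<-|/cf] := eqVneq u0 u; first by exists x0.
  by rewrite f0; case: (f u) => // x _; exists x.
by apply: (cQ i g) => u v /cf; rewrite !fg.
Qed.

(* For each ordered pair (i, j) of distinct colours, a copy of K_k whose edge
   {0, 1} has colour i and whose other edges have colour j. *)
Definition merge_gadget (I : finType) (l : I) (x y : I * I * 'I_k) : bool :=
  [&& x.1 == y.1, x.1.1 != x.1.2, x.2 != y.2 &
      l == (if x.2 + y.2 == 1 then x.1.1 else x.1.2)].

(** A monochromatic K_k would use every label once, but its edges {0, 1} and {0, 2} have different
    colours. *)
Lemma merge_gadget_coloring (I : finType) :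
  clique_free_coloring k (@merge_gadget I).
Proof.
split.
- move=> l [ij u] [ij' v]; rewrite /merge_gadget /= eq_sym.
  by case: eqP => //= ->; rewrite [u == v]eq_sym addnC.
- by move=> l x; rewrite /merge_gadget !eqxx /= andbF.
- by move=> l l' x y /and4P [_ _ _ /eqP ->] /and4P [_ _ _ /eqP ->].
move=> l f cf.
have g_inj : injective (fun u => (f u).2).
  move=> u v e; apply: contraTeq isT => /cf /and4P [_ _].
  by rewrite e eqxx.
pose h := invF g_inj.
have hK u : (f (h u)).2 = u by exact: (f_invF g_inj).
have cl u v : u != v -> [&& (f (h u)).1 == (f (h v)).1,
    (f (h u)).1.1 != (f (h u)).1.2 &
    l == (if u + v == 1 then (f (h u)).1.1 else (f (h u)).1.2)].
  move=> uv; have /cf : h u != h v.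
    by apply: contraNneq uv => e; rewrite -(hK u) e hK.
  by rewrite /merge_gadget !hK uv.
have k_gt1 : 1 < k by apply: leq_trans k_gt2.
have k_gt0 : 0 < k by apply: leq_trans k_gt2.
have /and3P [_ ne /eqP l1] := cl (Ordinal k_gt0) (Ordinal k_gt1) isT.
have /and3P [_ _ /eqP l2] := cl (Ordinal k_gt0) (Ordinal k_gt2) isT.
by move: ne; rewrite -[X in X != _]l1 -[X in _ != X]l2 eqxx.
Qed.

End Gadgets.

(** * The critical pattern *)

(** Read [inv d p] as the line of direction [d] through [p], and [ms] as the part forbidden on each
    line. The values of [chi] are chosen independently. *)
Lemma card_avoiding (D V L : finType) (inv : D -> V -> L) m (W : {set V})
    (ms : {ffun D * L -> 'I_m}) :
  #|[set chi : {ffun D * V -> 'I_m} | [forall dp,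
       (dp.2 \in W) ==> (chi dp != ms (dp.1, inv dp.1 dp.2))]]| =
  m.-1 ^ (#|D| * #|W|) * m ^ (#|D| * #|~: W|).
Proof.
pose F (dp : D * V) : pred 'I_m :=
  [pred j | (dp.2 \in W) ==> (j != ms (dp.1, inv dp.1 dp.2))].
transitivity #|(family F : simpl_pred {ffun D * V -> 'I_m})|.
  by apply: eq_card => chi; rewrite !inE.
rewrite card_family foldrE big_map big_enum /= (bigID (fun dp => dp.2 \in W)) /=.
have cardF (S : {set V}) : #|[pred dp : D * V | dp.2 \in S]| = #|D| * #|S|.
  rewrite -cardsT -cardsX; apply: eq_card => dp; rewrite !inE //.
rewrite -!cardF -!prod_nat_const; congr (_ * _).
  apply: eq_bigr => dp dpW.
  rewrite -[in RHS](card_ord m) -(cardC1 (ms (dp.1, inv dp.1 dp.2))).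
  by apply: eq_card => j; rewrite !inE dpW.
apply: eq_big => dp; first by rewrite !inE.
move=> dpW; rewrite -[in RHS](card_ord m); apply: eq_card => j.
by rewrite !inE (negPf dpW).
Qed.

(* Union bound: a bad partition is determined up to [card_avoiding] choices by
   a set W and, for every line, a part that W misses on that line. *)
Lemma exists_line_partition (D V L : finType) (inv : D -> V -> L) m
    (P : pred {set V}) :
  0 < m ->
  (forall W : {set V}, P W ->
     2 ^ #|V| * m ^ (#|D| * #|L|) * m.-1 ^ (#|D| * #|W|) < m ^ (#|D| * #|W|)) ->
  exists chi : D -> V -> 'I_m, forall W : {set V}, P W ->
    exists d l, forall j, exists p, [/\ p \in W, inv d p = l & chi d p = j].
Proof.
move=> m_gt0 hW.
pose bad (Wm : {set V} * {ffun D * L -> 'I_m}) :=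
  [set chi : {ffun D * V -> 'I_m} | [forall dp,
       (dp.2 \in Wm.1) ==> (chi dp != Wm.2 (dp.1, inv dp.1 dp.2))]].
(* The number of pairs of a set [W] and a choice of missed parts; each bad set has density below
   [1 / M]. *)
pose M := 2 ^ #|V| * m ^ (#|D| * #|L|).
have M_gt0 : 0 < M by rewrite muln_gt0 !expn_gt0 m_gt0.
have total : #|{ffun D * V -> 'I_m}| = m ^ (#|D| * #|V|).
  by rewrite card_ffun card_ord card_prod.
have total_gt0 : 0 < m ^ (#|D| * #|V|) by rewrite expn_gt0 m_gt0.
have bad_le Wm : P Wm.1 -> #|bad Wm| <= (m ^ (#|D| * #|V|)).-1 %/ M.
  move=> wW; rewrite leq_divRL // -ltnS prednK // card_avoiding mulnC mulnA.
  rewrite -(cardsC Wm.1) mulnDr expnD ltn_pmul2r ?expn_gt0 ?m_gt0 //.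
  exact: hW.
have [chi chiN] : exists chi : {ffun D * V -> 'I_m},
    chi \notin \bigcup_(Wm | P Wm.1) bad Wm.
  apply/existsP; rewrite -negb_forall; apply/negP => /forallP all_bad.
  have : #|{ffun D * V -> 'I_m}| <= \sum_(Wm | P Wm.1) #|bad Wm|.
    apply: (@leq_trans #|\bigcup_(Wm | P Wm.1) bad Wm|).
      by rewrite -cardsT; apply: subset_leq_card; apply/subsetP => chi _.
    elim/big_rec2: _ => [|Wm B n _ IH]; first by rewrite cards0.
    exact: leq_trans (leq_card_setU _ _) (leq_add (leqnn _) IH).
  rewrite total leqNgt => /negP; apply.
  apply: (@leq_ltn_trans
    (\sum_(Wm : {set V} * {ffun D * L -> 'I_m} | P Wm.1)
       (m ^ (#|D| * #|V|)).-1 %/ M)); first by apply: leq_sum => Wm; apply: bad_le.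
  rewrite sum_nat_const -[X in _ < X]prednK // ltnS.
  apply: leq_trans (leq_trunc_div _ M); rewrite mulnC leq_mul2l.
  apply/orP; right; apply: leq_trans (max_card _) _.
  by rewrite card_prod card_ffun card_ord card_prod -cardsT -powersetT
     card_powerset cardsT.
exists (fun d p => chi (d, p)) => W wW.
suff /existsP [d /existsP [l /forallP h]] : [exists d, exists l, forall j : 'I_m,
    exists p, [&& p \in W, inv d p == l & chi (d, p) == j]].
  exists d, l => j; have /existsP [p /and3P [pW /eqP pl /eqP pj]] := h j.
  by exists p.
apply: contraNT chiN => /existsPn h.
have [ms hms] : exists ms : D * L -> 'I_m, forall dl p,
    p \in W -> inv dl.1 p = dl.2 -> chi (dl.1, p) != ms dl.
  apply: (@fin_all_exists _ (fun=> 'I_m) (fun dl j => forall p,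
    p \in W -> inv dl.1 p = dl.2 -> chi (dl.1, p) != j)) => -[d l] /=.
  have /existsPn /(_ l) /forallPn [j /existsPn hj] := h d.
  exists j => p pW pl; have := hj p.
  by rewrite pW pl eqxx.
apply/bigcupP; exists (W, finfun ms) => //.
rewrite inE; apply/forallP => -[d p] /=; apply/implyP => pW.
by rewrite ffunE; apply: (hms (d, inv d p)).
Qed.

(** Bernoulli's inequality (1 + 1/n)^j >= 1 + j/n with denominators cleared. *)
Lemma bernoulli_expn n j : n ^ j * (n + j) <= n.+1 ^ j * n.
Proof.
elim: j => [|j IH]; first by rewrite !expn0 addn0.
rewrite [n.+1 ^ _]expnS -mulnA; apply: leq_trans (leq_mul (leqnn _) IH).
rewrite expnSr -mulnA [n.+1 * _]mulnCA leq_mul2l; apply/orP; right.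
by rewrite mulSn addnS mulnS leq_add2r leq_addr.
Qed.

Lemma line_partition_count m Q a : 1 < m -> 0 < Q -> m ^ 2 * Q <= a ->
  2 ^ Q * m ^ Q * m.-1 ^ a < m ^ a.
Proof.
case: m => [|[|n]] // _ Q_gt0 hQ /=; set m := n.+2.
(* Bernoulli gives 2 (m-1)^m < m^m; take m-th powers and use 2m <= 2^m. The Q-th power of [base]
   settles a = m^2 Q. *)
have base : 2 * m * n.+1 ^ (m ^ 2) < m ^ (m ^ 2).
  have h1 : 2 * n.+1 ^ m < m ^ m.
    rewrite -(ltn_pmul2r (ltn0Sn n)); apply: leq_trans (bernoulli_expn _ _).
    rewrite mulnAC mulnC ltn_pmul2l ?expn_gt0 //.
    by rewrite mul2n -addnn ltn_add2l.
  apply: leq_ltn_trans (_ : (2 * n.+1 ^ m) ^ m < _).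
    rewrite expnMn -expnM mulnn leq_mul2r; apply/orP; right.
    by rewrite expnS leq_mul2l /= ltn_expl.
  by rewrite -mulnn expnM ltn_exp2r.
have [e eQ] : exists e, e = m ^ 2 * Q by exists (m ^ 2 * Q).
rewrite -[_ * Q]/(m ^ 2 * Q) -eQ in hQ.
rewrite -(subnKC hQ) !(expnD _ e) mulnA.
apply: leq_ltn_trans (_ : 2 ^ Q * m ^ Q * n.+1 ^ e * m ^ (a - e) < _).
  rewrite leq_mul2l; apply/orP; right.
  by case: (a - e) => // j; rewrite leq_exp2r.
rewrite ltn_pmul2r ?expn_gt0 // eQ !(expnM _ (m ^ 2)) -!expnMn.
by rewrite ltn_exp2r.
Qed.

(** * Lines in F^3 with directions on conics *)

Section Geometry.
Import GRing.Theory.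
Local Open Scope ring_scope.
Variables (F : finFieldType) (I : finType) (alpha : I -> F) (m : nat).
Hypothesis alpha_inj : injective alpha.

Let V : finType := (F * F * F)%type.

(* Two points lie on a common line of direction (1, l, l^2 + alpha i) iff they
   have the same image under [line_of i l]. *)
Definition line_of (i : I) (l : F) (p : V) : F * F :=
  (p.1.2 - l * p.1.1, p.2 - (l ^+ 2 + alpha i) * p.1.1).

Lemma line_of_eq i l p q : line_of i l p = line_of i l q ->
  q.1.2 - p.1.2 = l * (q.1.1 - p.1.1) /\
  q.2 - p.2 = (l ^+ 2 + alpha i) * (q.1.1 - p.1.1).
Proof.
case: p q => [[x y] z] [[x' y'] z'] [/= e1 e2].
have -> : y' = y - l * x + l * x' by rewrite e1 subrK.
have -> : z' = z - (l ^+ 2 + alpha i) * x + (l ^+ 2 + alpha i) * x'.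
  by rewrite e2 subrK.
by split; ring.
Qed.

Variable chi : I -> F -> V -> 'I_m.

Definition adjacent i l (p q : V) : bool :=
  [&& p.1.1 != q.1.1, line_of i l p == line_of i l q & chi i l p != chi i l q].

Lemma adjacent_sym i l p q : adjacent i l p q = adjacent i l q p.
Proof.
by rewrite /adjacent eq_sym [line_of _ _ p == _]eq_sym [chi _ _ p == _]eq_sym.
Qed.

Lemma adjacent_slope i l p q : adjacent i l p q ->
  [/\ q.1.1 - p.1.1 != 0, q.1.2 - p.1.2 = l * (q.1.1 - p.1.1) &
      q.2 - p.2 = (l ^+ 2 + alpha i) * (q.1.1 - p.1.1)].
Proof.
case/and3P => ne /eqP /line_of_eq [e1 e2] _; split=> //.
by rewrite subr_eq0 eq_sym.
Qed.

Lemma adjacent_unique i j l l' p q :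
  adjacent i l p q -> adjacent j l' p q -> i = j /\ l = l'.
Proof.
move=> /adjacent_slope [ne e1 e2] /adjacent_slope [_ e1' e2'].
have ll' : l = l' by apply: (mulIf ne); rewrite -e1 -e1'.
split=> //; apply: alpha_inj; apply: (@addrI _ (l ^+ 2)).
by apply: (mulIf ne); rewrite -e2 e2' ll'.
Qed.

(* The directions (1, l, l^2 + alpha i), for fixed i, lie on a conic, so any
   three distinct ones are linearly independent. *)
Lemma adjacent_triangle i l1 l2 l3 p q w :
  adjacent i l1 p q -> adjacent i l2 q w -> adjacent i l3 p w -> l1 = l2.
Proof.
move=> /adjacent_slope [a0 e1 f1] /adjacent_slope [b0 e2 f2].
move=> /adjacent_slope [c0 e3 f3].
set a := q.1.1 - p.1.1 in a0 e1 f1; set b := w.1.1 - q.1.1 in b0 e2 f2.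
have cab : w.1.1 - p.1.1 = a + b by rewrite /a /b; ring.
rewrite cab in c0 e3 f3.
have e : l1 * a + l2 * b = l3 * (a + b) by rewrite -e1 -e2 -e3; ring.
have f : (l1 ^+ 2 + alpha i) * a + (l2 ^+ 2 + alpha i) * b =
         (l3 ^+ 2 + alpha i) * (a + b) by rewrite -f1 -f2 -f3; ring.
(* Eliminate [l3] through (a l1^2 + b l2^2)(a + b) - (a l1 + b l2)^2 = a b (l1 - l2)^2. *)
have : (l1 - l2) ^+ 2 * (a * b) = 0.
  have -> : (l1 - l2) ^+ 2 * (a * b) =
    ((l1 ^+ 2 + alpha i) * a + (l2 ^+ 2 + alpha i) * b) * (a + b)
    - alpha i * (a + b) ^+ 2 - (l1 * a + l2 * b) ^+ 2 by ring.
  by rewrite e f; ring.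
move/eqP; rewrite mulf_eq0 sqrf_eq0 mulf_eq0 (negPf a0) (negPf b0) !orbF subr_eq0.
by move/eqP.
Qed.

Definition pattern i (p q : V) : bool := [exists l, adjacent i l p q].

(** Every triangle lies on one line, hence so does every clique; there [chi] separates its vertices,
    so it has at most [m] of them. *)
Lemma pattern_coloring : clique_free_coloring m.+1 pattern.
Proof.
split.
- by move=> i p q; apply: eq_existsb => l; apply: adjacent_sym.
- by move=> i p; apply/existsP => -[l /and3P []]; rewrite eqxx.
- by move=> i j p q /existsP [l h] /existsP [l' /(adjacent_unique h) []].
move=> i f cf.
have [l adj] : exists l, forall u v, u != v -> adjacent i l (f u) (f v).
  have u1 : (1 < m.+1)%N.
    exact: leq_ltn_trans (leq0n _) (ltn_ord (chi i 0 (f ord0))).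
  have [l hl] := existsP (cf ord0 (Ordinal u1) isT).
  have adj0 u : ord0 != u -> adjacent i l (f ord0) (f u).
    move=> u0; have [<- //|uu] := eqVneq (Ordinal u1) u.
    have [l' hl'] := existsP (cf _ _ u0); have [l2 hl2] := existsP (cf _ _ uu).
    suff -> : l = l' by [].
    by rewrite adjacent_sym in hl; apply: adjacent_triangle hl hl' hl2.
  exists l => u v uv; have [u0|u0] := eqVneq ord0 u.
    by rewrite -u0 adj0 // u0.
  have [v0|v0] := eqVneq ord0 v; first by rewrite -v0 adjacent_sym adj0 // v0 eq_sym.
  have [l' hl'] := existsP (cf _ _ uv).
  by rewrite (adjacent_triangle (adj0 _ u0) hl' (adj0 _ v0)).
have chi_inj : injective (fun u => chi i l (f u)).
  by move=> u v e; apply: contraTeq isT => /adj /and3P [_ _]; rewrite e eqxx.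
by have := leq_card _ chi_inj; rewrite !card_ord ltnn.
Qed.

Lemma pattern_clique i l (f : 'I_m -> V) c :
  (forall j, line_of i l (f j) = c) -> (forall j, chi i l (f j) = j) ->
  clique (pattern i) f.
Proof.
move=> fl fc u v uv; apply/existsP; exists l.
rewrite /adjacent !fl !fc eqxx uv !andbT.
apply: contraNneq uv => x_eq; apply/eqP; rewrite -(fc u) -(fc v); congr (chi i l _).
move: (fl u) x_eq; rewrite -(fl v) /line_of => -[].
case: (f u) (f v) => [[x y] z] [[x' y'] z'] /= + + x_eq; rewrite x_eq.
by move=> /addIr -> /addIr ->.
Qed.

End Geometry.

Lemma critical_pattern m r : 1 < m -> 0 < r ->
  exists (V : finType) (R : 'I_r -> rel V),
    [/\ #|V| <= 8 * m ^ 6 * r ^ 3, clique_free_coloring m.+1 R &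
        forall chi : V -> 'I_r, exists i (f : 'I_m -> V),
          clique (R i) f /\ forall u, chi (f u) = i].
Proof.
move=> m_gt1 r_gt0.
have m_gt0 : 0 < m by apply: ltnW.
pose n := m ^ 2 * r; have n_gt1 : 1 < n.
  by apply: (@leq_mul 2 1) => //; apply: leq_trans m_gt1 _; apply: leq_pexp2l m_gt0 (isT : 1 <= 2).
(* Rounding [n] up to a power of 2 costs a factor of at most 2, whose cube is the 8 of the bound. *)
have /andP [lo hi] := up_log_bounds (isT : 1 < 2) n_gt1.
have s_gt0 : 0 < up_log 2 n by rewrite up_log_gt0.
have [F _ cardF] := pPrimePowerField (isT : prime 2) s_gt0.
set q := #|F| in cardF.
have q_ge : n <= q by rewrite cardF.
have q_le : q <= 2 * n by rewrite cardF -(prednK s_gt0) expnS leq_mul2l ltnW.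
have q_gt0 : 0 < q by apply: leq_trans q_ge; apply: ltnW.
have rq : r <= q by apply: leq_trans q_ge; rewrite leq_pmull // expn_gt0 m_gt0.
pose alpha (i : 'I_r) : F := enum_val (widen_ord rq i).
have alpha_inj : injective alpha.
  by move=> i j /enum_val_inj /(congr1 val) /= /val_inj.
pose V : finType := (F * F * F)%type.
have cardV : #|V| = q ^ 3 by rewrite !card_prod -/q !expnS mulnA muln1.
have partition i : exists chi : F -> V -> 'I_m, forall W : {set V},
    q ^ 3 <= r * #|W| -> exists d l, forall j, exists p,
      [/\ p \in W, line_of alpha i d p = l & chi d p = j].
  apply: (@exists_line_partition _ _ _ (line_of alpha i) _
    (fun W => q ^ 3 <= r * #|W|)) => // W qW.
  (* There are q directions and q^2 lines in each. The count needs m^2 q^3 <= q |W|, which follows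
     from m^2 r <= q and q^3 <= r |W|. *)
  rewrite cardV card_prod -/q (_ : q * (q * q) = q ^ 3) //.
  apply: line_partition_count => //; first by rewrite expn_gt0 q_gt0.
  rewrite -(leq_pmul2l r_gt0) mulnA [r * _]mulnC -/n [r * _]mulnCA.
  exact: leq_mul.
have [chi hchi] : exists chi : 'I_r -> F -> V -> 'I_m, forall i (W : {set V}),
    q ^ 3 <= r * #|W| -> exists d l, forall j, exists p,
      [/\ p \in W, line_of alpha i d p = l & chi i d p = j].
  exact: (@fin_all_exists _ _ (fun i (chi : F -> V -> 'I_m) => forall W : {set V},
    q ^ 3 <= r * #|W| -> exists d l, forall j, exists p,
      [/\ p \in W, line_of alpha i d p = l & chi d p = j])) partition.
exists V, (pattern alpha chi); split.
- rewrite cardV; apply: leq_trans (_ : (2 * n) ^ 3 <= _); first by rewrite leq_exp2r.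
  by rewrite /n expnMn [(_ * r) ^ 3]expnMn -expnM mulnA.
- exact: pattern_coloring.
move=> c.
have [i hi'] := pigeonhole (Ordinal r_gt0) [set: V] c.
rewrite cardsT cardV card_ord in hi'.
have [d [l hf]] := hchi i _ hi'.
have [f hf'] := @fin_all_exists _ _ (fun j p => [/\ p \in [set x in [set: V] | c x == i],
  line_of alpha i d p = l & chi i d p = j]) hf.
exists i, f; split.
  apply: (@pattern_clique _ _ _ _ _ _ d _ l) => j; by have [] := hf' j.
by move=> u; have [+ _ _] := hf' u; rewrite !inE => /eqP.
Qed.

(** * Attaching apex vertices to the edge-Ramsey graph *)

Theorem theorem3 (k r : nat) (hk : 3 <= k) (hr : 3 <= r) :
  exists (n : nat) (V : {set 'I_n}) (E : rel 'I_n),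
    ramsey_minimal V E (complete k) r /\
    mindeg V E <= 8 * (k - 1) ^ 6 * r ^ 3.
Proof.
case: k hk => [//|m] hk; rewrite subn1 /=.
have r_gt1 : 1 < r by apply: leq_trans hr.
have r_gt0 : 0 < r by apply: leq_trans hr.
have [V0 [R0 [cardV0 R0k R0crit]]] := @critical_pattern m r hk r_gt0.
have [X [S [Sk hX]]] := clique_free_edge_ramsey 'I_r hk
  (clique_free_sum hk R0k (merge_gadget_coloring hk 'I_r)).
have [S_sym S_irr S_disj S_free] := Sk.
pose G : finType := (X + {ffun V0 -> X})%type.
pose E (x y : G) := match x, y with
  | inl x, inl y => [exists i, S i x y]
  | inl x, inr F | inr F, inl x => [exists p, F p == x]
  | inr _, inr _ => false end.
pose i0 := Ordinal r_gt0.
pose color0 (x y : G) : 'I_r := match x, y with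
  | inl x, inl y => odflt i0 [pick i | S i x y] | _, _ => i0 end.
apply: (@low_degree_minimal _ r _ G E [set x | if x is inr _ then true else false]).
- move=> [x|F] [y|F'] //=; apply: eq_existsb => i; exact: S_sym.
- by move=> [x|F] //=; apply/existsP => -[i]; rewrite S_irr.
- move=> c c_sym; case: (classic (exists col, contains_copy setT
      (fun x y => E x y && (c x y == col)) (complete m.+1))) => // noc; exfalso.
  have [g [g_inj gS gc]] := hX (fun x y => c (inl x) (inl y)) (fun x y => c_sym _ _).
  have m_gt1 : 1 < m.+1 by apply: leq_trans hk.
  pose u0 : 'I_m.+1 := ord0; pose u1 : 'I_m.+1 := Ordinal m_gt1.
  pose i1 := Ordinal r_gt1.
  pose other i := if i == i0 then i1 else i0.
  have other_neq i : i != other i by rewrite /other; case: (eqVneq i i0) => [->|].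
  pose gad i j u : V0 + 'I_r * 'I_r * 'I_m.+1 := inr ((i, j), u).
  (* The common colour of the [i]-edges of the copy, read off edge {0, 1} of a gadget. *)
  pose sig i := c (inl (g (gad i (other i) u0))) (inl (g (gad i (other i) u1))).
  have sigE i x y : (match x, y with
      | inl x, inl y => R0 i x y
      | inr x, inr y => merge_gadget i x y
      | _, _ => false end) -> c (inl (g x)) (inl (g y)) = sig i.
    move=> Rxy; apply: (gc i) => //.
    by rewrite /merge_gadget /= !eqxx other_neq.
  (* If [sig i = sig j], the gadget of [(i, j)] is a monochromatic K_k. *)
  have sig_inj : injective sig.
    move=> i j eij; have [//|ij] := eqVneq i j; case: noc.
    exists (sig i), (fun u => inl (g (gad i j u))); split=> //.
      by move=> u v [] /g_inj [].
    rewrite /complete => u v uv; set l := if u + v == 1 then i else j.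
    have Ruv : merge_gadget l ((i, j), u) ((i, j), v).
      by rewrite /merge_gadget /= !eqxx ij uv.
    apply/andP; split; first by apply/existsP; exists l; apply: (gS l).
    rewrite (sigE l) // /l; case: ifP => _; rewrite ?eqxx // eij eqxx //.
  pose F := [ffun p => g (inl p)].
  (* The colours at the apex of this copy, renamed by the inverse of [sig], colour [V0]; the K_m
     obtained and the apex form a monochromatic K_k. *)
  have [i [f [cf fi]]] := R0crit (fun p => invF sig_inj (c (inr F) (inl (F p)))).
  have f_inj : injective f.
    have [_ R0_irr _ _] := R0k.
    by move=> u v e; apply: contraTeq isT => /cf; rewrite e R0_irr.
  have apex u : c (inr F) (inl (g (inl (f u)))) = sig i.
    by rewrite -(fi u) f_invF ffunE.
  pose h u : G := if unlift ord0 u is Some j then inl (g (inl (f j))) else inr F.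
  apply: noc; exists (sig i), h; split=> //.
    move=> u v; rewrite /h.
    case: unliftP => [u' ->|->]; case: unliftP => [v' ->|->] //.
    by move=> [] /g_inj [] /f_inj ->.
  have edge_apex u : E (inr F) (inl (g (inl (f u)))).
    by apply/existsP; exists (f u); rewrite ffunE.
  move=> u v; rewrite /complete /h.
  case: (unliftP ord0 u) => [u' ->|->]; case: (unliftP ord0 v) => [v' ->|->].
  + rewrite (inj_eq lift_inj) => uv; have Ruv := cf _ _ uv.
    rewrite (sigE i) // eqxx andbT; apply/existsP; exists i.
    exact: (gS i (inl _) (inl _)).
  + by rewrite c_sym apex eqxx andbT => _; apply: edge_apex.
  + by rewrite apex eqxx andbT => _; apply: edge_apex.
  by rewrite eqxx.
(* Away from the apex vertices, [color0] gives each edge its class in [S]. *)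
- exists color0; split.
    move=> [x|F] [y|F'] //=; congr odflt; apply: eq_pick => i.
    exact: S_sym.
  move=> i [f [f_inj fX fE]].
  have [g fg] : exists g : 'I_m.+1 -> X, forall u, f u = inl (g u).
    apply: (@fin_all_exists _ (fun=> X) (fun u x => f u = inl x)) => u.
    by have := fX u; rewrite !inE; case: (f u) => // x _; exists x.
  apply: (S_free i g) => u v /fE; rewrite !fg => /andP [/existsP [j Sj]] /=.
  by case: pickP => [l Sl /= /eqP <- //|/(_ j)]; rewrite Sj.
move=> [x|F]; rewrite inE // => _; apply: leq_trans cardV0.
have -> : [set u | E (inr F) u] = inl @: (F @: [set: V0]).
  apply/setP => -[x|F']; rewrite inE /=.
    apply/existsP/imsetP => [[p /eqP <-]|[_ /imsetP [p _ ->] [->]]].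
      by exists (F p) => //; apply: imset_f.
    by exists p.
  by apply/esym/imsetP => -[].
rewrite card_imset; last by move=> x y [].
by rewrite -cardsT leq_imset_card.
Qed.
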